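(* For every triangle, $$X_3X_9\le X_3X_{10}\le X_3X_2\le X_3X_{12}\le X_3X_7\le X_3X_4.$$
   Context: For a (nondegenerate) triangle $ABC$ with side lengths $a=BC$, $b=CA$, $c=AB$, a point with barycentric coordinates $(u:v:w)$ is $(uA+vB+wC)/(u+v+w)$. The triangle center $X_n$ is the point with barycentric coordinates $(f_n(a,b,c):f_n(b,c,a):f_n(c,a,b))$, where $f_2=1$ (centroid); $f_3=a^2(a^2-b^2-c^2)$ (circumcenter); $f_4=(a^2+b^2-c^2)(a^2-b^2+c^2)$ (orthocenter); $f_7=(a+b-c)(a-b+c)$ (Gergonne point); $f_9=a(a-b-c)$ (mittenpunkt); $f_{10}=b+c$ (Spieker center); $f_{12}=(a+b-c)(a-b+c)(b+c)^2$. $X_iX_j$ denotes the Euclidean distance between $X_i$ and $X_j$. *)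

(* Defs.v *)
From Stdlib Require Import Reals.
Open Scope R_scope.

Definition point : Type := (R * R)%type.

Definition distance (P Q : point) : R := dist_euc (fst P) (snd P) (fst Q) (snd Q).

Definition collinear (A B C : point) : Prop :=
  exists p q r : R,
    (p <> 0 \/ q <> 0) /\
    p * fst A + q * snd A = r /\
    p * fst B + q * snd B = r /\
    p * fst C + q * snd C = r.

Definition nondegenerate (A B C : point) : Prop := ~ collinear A B C.

(* Only meaningful when u + v + w <> 0. For the centers below and a
   nondegenerate triangle of area S, the sum is -16 S^2 for f_3, 16 S^2 for f_4,
   positive for f_2, f_7, f_10, f_12 and negative for f_9. *)
Definition barycentric (A B C : point) (u v w : R) : point :=
  ((u * fst A + v * fst B + w * fst C) / (u + v + w),
   (u * snd A + v * snd B + w * snd C) / (u + v + w)).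

Definition center (f : R -> R -> R -> R) (A B C : point) : point :=
  let a := distance B C in
  let b := distance C A in
  let c := distance A B in
  barycentric A B C (f a b c) (f b c a) (f c a b).

Definition f_2 (a b c : R) : R := 1.
Definition f_3 (a b c : R) : R := a^2 * (a^2 - b^2 - c^2).
Definition f_4 (a b c : R) : R := (a^2 + b^2 - c^2) * (a^2 - b^2 + c^2).
Definition f_7 (a b c : R) : R := (a + b - c) * (a - b + c).
Definition f_9 (a b c : R) : R := a * (a - b - c).
Definition f_10 (a b c : R) : R := b + c.
Definition f_12 (a b c : R) : R := (a + b - c) * (a - b + c) * (b + c)^2.

(* The numbering is that of Kimberling's Encyclopedia of Triangle Centers. *)
Definition X_2 := center f_2.
Definition X_3 := center f_3.
Definition X_4 := center f_4.
Definition X_7 := center f_7.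
Definition X_9 := center f_9.
Definition X_10 := center f_10.
Definition X_12 := center f_12.

(* Main.v *)
Require Import Defs.
From Stdlib Require Import Reals Lra.
Open Scope R_scope.

(** With O the circumcenter and rho the squared circumradius, a point P of
    barycentric coordinates (u : v : w) satisfies
    OP^2 = rho - (a^2 v w + b^2 w u + c^2 u v) / (u + v + w)^2, so each comparison
    of distances becomes the reverse comparison of the subtracted fractions.
    In Ravi coordinates a = y + z, b = z + x, c = x + y these are rational functions
    of p = x + y + z, q = y z + z x + x y and r = x y z, and the inequalities
    follow from p^2 >= 3 q, q^2 >= 3 p r, p q >= 9 r and Schur's
    inequality for y z, z x, x y, which reads q^3 - 4 p q r + 9 r^2 >= 0. *)

(** * Distances from the circumcenter to points given by barycentric coordinates *)

Definition weight_sum (f : R -> R -> R -> R) (a b c : R) : R :=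
  f a b c + f b c a + f c a b.

(* Minus the power with respect to the circumcircle. *)
Definition inner_power (f : R -> R -> R -> R) (a b c : R) : R :=
  (a^2 * (f b c a * f c a b) + b^2 * (f c a b * f a b c)
   + c^2 * (f a b c * f b c a)) / (weight_sum f a b c)^2.

Definition sq_dist (P Q : point) : R := (fst P - fst Q)^2 + (snd P - snd Q)^2.

Definition double_area (A B C : point) : R :=
  (fst B - fst A) * (snd C - snd A) - (snd B - snd A) * (fst C - fst A).

Lemma distance_sqrt (P Q : point) : distance P Q = sqrt (sq_dist P Q).
Proof. unfold distance, dist_euc, sq_dist, Rsqr. f_equal. ring. Qed.

Lemma distance_nonneg (P Q : point) : 0 <= distance P Q.
Proof. rewrite distance_sqrt. apply sqrt_pos. Qed.

Lemma distance_sq (P Q : point) : (distance P Q)^2 = sq_dist P Q.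
Proof.
rewrite distance_sqrt. apply pow2_sqrt.
apply Rplus_le_le_0_compat; apply pow2_ge_0.
Qed.

Lemma double_area_neq0 (A B C : point) :
  nondegenerate A B C -> double_area A B C <> 0.
Proof.
destruct A as [a1 a2], B as [b1 b2], C as [c1 c2].
unfold nondegenerate, collinear, double_area; simpl. intros H E. apply H.
(* The common line is AB when A and B differ. When they coincide it is the vertical line through A
   or the line AC, according to whether C lies on that vertical line. *)
destruct (Req_dec b1 a1) as [E1 | N1]; [destruct (Req_dec b2 a2) as [E2 | N2] |].
- subst. destruct (Req_dec c1 a1) as [E1 | N1].
  + subst. exists 1, 0, a1. repeat split; lra.
  + exists (a2 - c2), (c1 - a1), ((a2 - c2) * a1 + (c1 - a1) * a2).
    repeat split; try (right; lra); ring.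
- exists (a2 - b2), (b1 - a1), ((a2 - b2) * a1 + (b1 - a1) * a2).
  repeat split; try (left; lra); lra.
- exists (a2 - b2), (b1 - a1), ((a2 - b2) * a1 + (b1 - a1) * a2).
  repeat split; try (right; lra); lra.
Qed.

Lemma heron (A B C : point) :
  let a := distance B C in let b := distance C A in let c := distance A B in
  (a + b + c) * (b + c - a) * (c + a - b) * (a + b - c)
  = 4 * (double_area A B C)^2.
Proof.
intros a b c.
(* Only squares of the sides occur in this form, so [distance_sq] makes everything polynomial in the
   coordinates. *)
transitivity (2 * (a^2 * b^2 + b^2 * c^2 + c^2 * a^2)
              - ((a^2)^2 + (b^2)^2 + (c^2)^2)); [ring |].
unfold a, b, c. rewrite !distance_sq. unfold sq_dist, double_area. ring.
Qed.

(** The strict triangle inequalities come from the sign of Heron's product. Any two of its last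
    three factors have a sum equal to twice a side; if one of them were nonpositive, the other two
    would be nonnegative and the product could not be positive. *)
Lemma ravi (a b c : R) :
  0 <= a -> 0 <= b -> 0 <= c ->
  0 < (a + b + c) * (b + c - a) * (c + a - b) * (a + b - c) ->
  exists x y z, (0 < x /\ 0 < y /\ 0 < z) /\ a = y + z /\ b = z + x /\ c = x + y.
Proof.
assert (two_factors : forall s t u v, 0 <= s -> 0 < s * t * u * v -> 0 <= t + u ->
          0 <= u + v -> 0 <= v + t -> 0 < t /\ 0 < u /\ 0 < v).
{ intros s t u v Hs H Htu Huv Hvt.
  assert (Hp : 0 < t * u * v) by (apply Rnot_le_lt; intro; nra).
  repeat split; apply Rnot_le_lt; intro Hneg.
  - assert (0 <= u * v) by (apply Rmult_le_pos; lra). nra.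
  - assert (0 <= t * v) by (apply Rmult_le_pos; lra). nra.
  - assert (0 <= t * u) by (apply Rmult_le_pos; lra). nra. }
intros Ha Hb Hc H.
destruct (two_factors (a + b + c) (b + c - a) (c + a - b) (a + b - c))
  as (Hx & Hy & Hz); try lra.
exists ((b + c - a) / 2), ((c + a - b) / 2), ((a + b - c) / 2).
repeat split; lra.
Qed.

Lemma circumcenter_equidistant (A B C : point) :
  double_area A B C <> 0 ->
  sq_dist (X_3 A B C) B = sq_dist (X_3 A B C) A /\
  sq_dist (X_3 A B C) C = sq_dist (X_3 A B C) A.
Proof.
intro H.
unfold X_3, center, f_3, barycentric. rewrite !distance_sq.
destruct A as [a1 a2], B as [b1 b2], C as [c1 c2].
unfold sq_dist, double_area in *; simpl fst in *; simpl snd in *.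
(* The sum of the weights is -16 S^2, written through the doubled area so that [field] asks only for
   [H]. *)
match goal with |- context [_ / ?s] =>
  replace s with (- 4 * ((b1 - a1) * (c2 - a2) - (b2 - a2) * (c1 - a1))^2) by ring
end.
split; field; exact H.
Qed.

Lemma sq_dist_barycentric (A B C O : point) (rho u v w : R) :
  u + v + w <> 0 ->
  sq_dist O A = rho -> sq_dist O B = rho -> sq_dist O C = rho ->
  sq_dist O (barycentric A B C u v w) =
  rho - (sq_dist B C * (v * w) + sq_dist C A * (w * u) + sq_dist A B * (u * v))
        / (u + v + w)^2.
Proof.
intros Hs HA HB HC.
(* Once rho is written as the weighted mean of OA^2, OB^2 and OC^2, the claim is Leibniz's identity,
   valid for every point O. *)
replace rho with ((u * sq_dist O A + v * sq_dist O B + w * sq_dist O C) / (u + v + w))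
  by (rewrite HA, HB, HC; field; exact Hs).
unfold sq_dist, barycentric; simpl. field. exact Hs.
Qed.

Lemma distance_circumcenter_le (A B C : point) (f g : R -> R -> R -> R) :
  let a := distance B C in let b := distance C A in let c := distance A B in
  double_area A B C <> 0 ->
  weight_sum f a b c <> 0 -> weight_sum g a b c <> 0 ->
  inner_power g a b c <= inner_power f a b c ->
  distance (X_3 A B C) (center f A B C) <= distance (X_3 A B C) (center g A B C).
Proof.
intros a b c Hd Hf Hg Hle.
destruct (circumcenter_equidistant A B C Hd) as [HB HC].
rewrite !distance_sqrt. apply sqrt_le_1_alt. unfold center; cbv zeta.
unfold a, b, c in Hf, Hg, Hle.
rewrite (sq_dist_barycentric A B C _ _ _ _ _ Hf eq_refl HB HC).
rewrite (sq_dist_barycentric A B C _ _ _ _ _ Hg eq_refl HB HC).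
rewrite <- !distance_sq. unfold inner_power, weight_sum in Hle. lra.
Qed.

Lemma schur_deg3 (x y z : R) :
  0 <= x -> 0 <= y -> 0 <= z ->
  0 <= x * (x - y) * (x - z) + y * (y - z) * (y - x) + z * (z - x) * (z - y).
Proof.
assert (ordered : forall u v w, 0 <= w -> w <= v -> v <= u ->
          0 <= u * (u - v) * (u - w) + v * (v - w) * (v - u) + w * (w - u) * (w - v)).
{ intros u v w Hw Hwv Hvu.
  (* The first two Schur terms add up to this product, and the third is the product in the next
     assertion. *)
  assert (0 <= (u - v)^2 * (u + v - w)) by (apply Rmult_le_pos; [apply pow2_ge_0 | lra]).
  assert (0 <= w * ((u - w) * (v - w))) by (repeat apply Rmult_le_pos; lra).
  lra. }
intros Hx Hy Hz.
destruct (Rle_dec x y), (Rle_dec y z), (Rle_dec z x);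
  first [ pose proof (ordered x y z ltac:(lra) ltac:(lra) ltac:(lra)); lra
        | pose proof (ordered x z y ltac:(lra) ltac:(lra) ltac:(lra)); lra
        | pose proof (ordered y x z ltac:(lra) ltac:(lra) ltac:(lra)); lra
        | pose proof (ordered y z x ltac:(lra) ltac:(lra) ltac:(lra)); lra
        | pose proof (ordered z x y ltac:(lra) ltac:(lra) ltac:(lra)); lra
        | pose proof (ordered z y x ltac:(lra) ltac:(lra) ltac:(lra)); lra ].
Qed.

(** Each comparison below supplies the difference of its two sides as a single fraction: [field]
    checks the identity, and the numerator is arranged so that its sign follows from the section
    hypotheses. *)
Lemma Rle_of_sub_eq_div (s t n d : R) : t - s = n / d -> 0 <= n -> 0 < d -> s <= t.
Proof.
intros E Hn Hd. assert (0 <= n / d) by (apply Rle_mult_inv_pos; assumption). lra.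
Qed.

Ltac nonneg := repeat first [apply Rmult_le_pos | apply pow_le]; lra.
Ltac positive := repeat first [apply Rmult_lt_0_compat | apply pow_lt]; lra.

Section SymmetricInequalities.

Variables p q r : R.
Hypotheses (p_gt0 : 0 < p) (q_gt0 : 0 < q) (r_gt0 : 0 < r).
Hypotheses (p2_ge_3q : 0 <= p^2 - 3 * q) (q2_ge_3pr : 0 <= q^2 - 3 * p * r)
  (pq_ge_9r : 0 <= p * q - 9 * r) (schur_pqr : 0 <= q^3 - 4 * p * q * r + 9 * r^2).

Lemma pqr_9_10 :
  (p^3 - p * q - 2 * r) / (4 * p) <= (p * q - r) * (p * q - 3 * r) / (4 * q^2).
Proof.
apply (Rle_of_sub_eq_div _ _
  (p * (q^3 - 4 * p * q * r + 9 * r^2) + 2 * r * (q^2 - 3 * p * r)) (4 * p * q^2)).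
- field; lra.
- assert (0 <= p * (q^3 - 4 * p * q * r + 9 * r^2)) by nonneg.
  assert (0 <= r * (q^2 - 3 * p * r)) by nonneg. lra.
- positive.
Qed.

Lemma pqr_10_2 : 2 * (p^2 - q) / 9 <= (p^3 - p * q - 2 * r) / (4 * p).
Proof.
apply (Rle_of_sub_eq_div _ _
  (p * (p^2 - 3 * q) + 2 * (p * q - 9 * r)) (36 * p)).
- field; lra.
- assert (0 <= p * (p^2 - 3 * q)) by nonneg. lra.
- positive.
Qed.

(** The numerator is split along p^2 - 3q, pq - 9r and q^2 - 3pr, which all vanish when x = y = z.
    [H1] and [H2] give the signs of the multipliers of the first two. *)
Lemma pqr_2_12 :
  r * (4 * p^4 * q - 7 * p^2 * q^2 + 28 * p^3 * r - 14 * p * q * r - 11 * r^2)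
    / (p * (p * q + 7 * r)^2) <= 2 * (p^2 - q) / 9.
Proof.
assert (Hpq : 0 < p * q) by positive.
assert (Hcube : 0 <= p^3 - 27 * r).
{ assert (0 <= p * (p^2 - 3 * q)) by nonneg. lra. }
assert (H1 : 0 <= 2 * p^3 * q^2 - 39 * p * r^2).
{ assert (0 <= p * ((p * q - 9 * r) * (p * q + 9 * r))) by nonneg.
  assert (0 < p * r^2) by positive. lra. }
assert (H2 : 0 <= 4 * p^4 * q + 12 * p^3 * r - 33 * r^2).
{ assert (0 <= r * (p^3 - 27 * r)) by nonneg.
  assert (0 < p^4 * q) by positive. assert (0 < r^2) by positive. lra. }
apply (Rle_of_sub_eq_div _ _
  ((p^2 - 3 * q) * (2 * p^3 * q^2 - 39 * p * r^2)
   + (p * q - 9 * r) * (4 * p^4 * q + 12 * p^3 * r - 33 * r^2)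
   + 105 * p^2 * r * (q^2 - 3 * p * r)) (27 * p * (p * q + 7 * r)^2)).
- field; lra.
- assert (0 <= (p^2 - 3 * q) * (2 * p^3 * q^2 - 39 * p * r^2)) by nonneg.
  assert (0 <= (p * q - 9 * r) * (4 * p^4 * q + 12 * p^3 * r - 33 * r^2)) by nonneg.
  assert (0 <= p^2 * r * (q^2 - 3 * p * r)) by nonneg. lra.
- positive.
Qed.

(** Here p^2 - 3q and pq - 9r suffice for the splitting, with multipliers that are sums of positive
    terms. *)
Lemma pqr_12_7 :
  r * (p * q + 3 * r) / q^2 <=
  r * (4 * p^4 * q - 7 * p^2 * q^2 + 28 * p^3 * r - 14 * p * q * r - 11 * r^2)
    / (p * (p * q + 7 * r)^2).
Proof.
assert (Hpq : 0 < p * q) by positive.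
apply (Rle_of_sub_eq_div _ _
  (r * ((p^2 - 3 * q)
          * (63 * p^2 * q^3 + 137 * p * q^2 * r)
        + (p * q - 9 * r)
          * (18 * p^3 * q^2 + 273 * p^2 * q * r + 49 * p * r * (p * q + 9 * r)
             + 33 * q^2 * r)))
  (27 * p * q^2 * (p * q + 7 * r)^2)).
- field; lra.
- apply Rmult_le_pos; [lra | apply Rplus_le_le_0_compat]; apply Rmult_le_pos; try lra.
  + assert (0 < p^2 * q^3) by positive. assert (0 < p * q^2 * r) by positive. lra.
  + assert (0 < p^3 * q^2) by positive. assert (0 < p^2 * q * r) by positive.
    assert (0 < p * r * (p * q + 9 * r)) by positive.
    assert (0 < q^2 * r) by positive. lra.
- positive.
Qed.

Lemma pqr_7_4 :
  2 * (p^2 - q) - (p * q - r)^2 / (2 * p * r) <= r * (p * q + 3 * r) / q^2.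
Proof.
apply (Rle_of_sub_eq_div _ _
  ((p^2 * q + 2 * p * r) * (q^3 - 4 * p * q * r + 9 * r^2)
   + r^2 * ((q^2 - 3 * p * r) + p * (p * q - 9 * r))) (2 * p * r * q^2)).
- field; lra.
- assert (0 < p^2 * q) by positive. assert (0 < p * r) by positive.
  assert (0 <= p * (p * q - 9 * r)) by nonneg.
  apply Rplus_le_le_0_compat; apply Rmult_le_pos; try nonneg; lra.
- positive.
Qed.

End SymmetricInequalities.

(** * The centers in Ravi coordinates, and the conclusion *)

Lemma inner_powers_sorted (x y z : R) :
  0 < x -> 0 < y -> 0 < z ->
  let a := y + z in let b := z + x in let c := x + y in
  inner_power f_10 a b c <= inner_power f_9 a b c /\
  inner_power f_2 a b c <= inner_power f_10 a b c /\
  inner_power f_12 a b c <= inner_power f_2 a b c /\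
  inner_power f_7 a b c <= inner_power f_12 a b c /\
  inner_power f_4 a b c <= inner_power f_7 a b c.
Proof.
intros Hx Hy Hz a b c.
pose (p := x + y + z). pose (q := y * z + z * x + x * y). pose (r := x * y * z).
assert (Hyz : 0 < y * z) by positive.
assert (Hzx : 0 < z * x) by positive.
assert (Hxy : 0 < x * y) by positive.
assert (Hp : 0 < p) by (unfold p; lra).
assert (Hq : 0 < q) by (unfold q; lra).
assert (Hr : 0 < r) by (unfold r; positive).
assert (Hpq : 0 < p * q) by positive.
assert (H1 : 0 <= p^2 - 3 * q).
{ unfold p, q. pose proof (pow2_ge_0 (x - y)). pose proof (pow2_ge_0 (y - z)).
  pose proof (pow2_ge_0 (z - x)). lra. }
assert (H2 : 0 <= q^2 - 3 * p * r).
{ unfold p, q, r. pose proof (pow2_ge_0 (x * y - y * z)).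
  pose proof (pow2_ge_0 (y * z - z * x)). pose proof (pow2_ge_0 (z * x - x * y)). lra. }
assert (H3 : 0 <= p * q - 9 * r).
{ unfold p, q, r.
  assert (0 <= x * (y - z)^2) by (apply Rmult_le_pos; [lra | apply pow2_ge_0]).
  assert (0 <= y * (z - x)^2) by (apply Rmult_le_pos; [lra | apply pow2_ge_0]).
  assert (0 <= z * (x - y)^2) by (apply Rmult_le_pos; [lra | apply pow2_ge_0]). lra. }
assert (H4 : 0 <= q^3 - 4 * p * q * r + 9 * r^2).
(* The elementary symmetric functions of yz, zx and xy are q, pr and r^2. *)
{ unfold p, q, r. pose proof (schur_deg3 (y * z) (z * x) (x * y)). lra. }
assert (E2 : inner_power f_2 a b c = 2 * (p^2 - q) / 9).
{ unfold inner_power, weight_sum, f_2, a, b, c, p, q. field. }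
(* This is a^2 + b^2 + c^2 - 8 R^2 with R the circumradius, since abc = pq - r, S^2 = pr and R = abc
   / (4 S). *)
assert (E4 : inner_power f_4 a b c
             = 2 * (p^2 - q) - (p * q - r)^2 / (2 * p * r)).
{ unfold inner_power.
  replace (weight_sum f_4 a b c) with (16 * (p * r))
    by (unfold weight_sum, f_4, a, b, c, p, r; ring).
  apply (Rmult_eq_reg_r (256 * (p * r)^2));
    [| apply Rgt_not_eq; positive].
  transitivity (a^2 * (f_4 b c a * f_4 c a b) + b^2 * (f_4 c a b * f_4 a b c)
                + c^2 * (f_4 a b c * f_4 b c a)); [field; lra |].
  transitivity (512 * (p^2 - q) * (p * r)^2 - 128 * (p * q - r)^2 * (p * r));
    [| field; lra].
  unfold f_4, a, b, c, p, q, r. ring. }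
assert (E7 : inner_power f_7 a b c = r * (p * q + 3 * r) / q^2).
{ unfold inner_power.
  replace (weight_sum f_7 a b c) with (4 * q)
    by (unfold weight_sum, f_7, a, b, c, q; ring).
  (* The right side is brought to the denominator [(4 * q)^2] of the left, so that [f_equal] leaves
     a polynomial identity between numerators. The remaining centers are treated alike. *)
  replace (r * (p * q + 3 * r) / q^2) with (16 * (r * (p * q + 3 * r)) / (4 * q)^2)
    by (field; lra).
  f_equal. unfold f_7, a, b, c, p, q, r. ring. }
assert (E9 : inner_power f_9 a b c = (p * q - r) * (p * q - 3 * r) / (4 * q^2)).
{ unfold inner_power.
  replace (weight_sum f_9 a b c) with (- 4 * q)
    by (unfold weight_sum, f_9, a, b, c, q; ring).
  replace ((p * q - r) * (p * q - 3 * r) / (4 * q^2))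
    with (4 * ((p * q - r) * (p * q - 3 * r)) / (- 4 * q)^2) by (field; lra).
  f_equal. unfold f_9, a, b, c, p, q, r. ring. }
assert (E10 : inner_power f_10 a b c = (p^3 - p * q - 2 * r) / (4 * p)).
{ unfold inner_power.
  replace (weight_sum f_10 a b c) with (4 * p)
    by (unfold weight_sum, f_10, a, b, c, p; ring).
  replace ((p^3 - p * q - 2 * r) / (4 * p))
    with (4 * p * (p^3 - p * q - 2 * r) / (4 * p)^2) by (field; lra).
  f_equal. unfold f_10, a, b, c, p, q, r. ring. }
assert (E12 : inner_power f_12 a b c
  = r * (4 * p^4 * q - 7 * p^2 * q^2 + 28 * p^3 * r - 14 * p * q * r - 11 * r^2)
    / (p * (p * q + 7 * r)^2)).
{ unfold inner_power.
  replace (weight_sum f_12 a b c) with (4 * p * (p * q + 7 * r))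
    by (unfold weight_sum, f_12, a, b, c, p, q, r; ring).
  transitivity (16 * p * (r * (4 * p^4 * q - 7 * p^2 * q^2 + 28 * p^3 * r
                               - 14 * p * q * r - 11 * r^2))
                / (4 * p * (p * q + 7 * r))^2); [| field; lra].
  f_equal. unfold f_12, a, b, c, p, q, r. ring. }
rewrite E2, E4, E7, E9, E10, E12.
repeat split;
  [apply pqr_9_10 | apply pqr_10_2 | apply pqr_2_12 | apply pqr_12_7 | apply pqr_7_4];
  assumption.
Qed.

Lemma weight_sums_neq0 (x y z : R) :
  0 < x -> 0 < y -> 0 < z ->
  let a := y + z in let b := z + x in let c := x + y in
  weight_sum f_2 a b c <> 0 /\ weight_sum f_4 a b c <> 0 /\
  weight_sum f_7 a b c <> 0 /\ weight_sum f_9 a b c <> 0 /\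
  weight_sum f_10 a b c <> 0 /\ weight_sum f_12 a b c <> 0.
Proof.
intros Hx Hy Hz a b c.
assert (Hyz : 0 < y * z) by positive.
assert (Hzx : 0 < z * x) by positive.
assert (Hxy : 0 < x * y) by positive.
repeat split.
- unfold weight_sum, f_2. lra.
- replace (weight_sum f_4 a b c) with (16 * ((x + y + z) * (x * y * z)))
    by (unfold weight_sum, f_4, a, b, c; ring).
  apply Rgt_not_eq; positive.
- replace (weight_sum f_7 a b c) with (4 * (y * z + z * x + x * y))
    by (unfold weight_sum, f_7, a, b, c; ring).
  lra.
- replace (weight_sum f_9 a b c) with (- 4 * (y * z + z * x + x * y))
    by (unfold weight_sum, f_9, a, b, c; ring).
  lra.
- unfold weight_sum, f_10, a, b, c. lra.
- unfold weight_sum, f_12, a, b, c.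
  (* The three weights are four times these products, because a + b - c = 2z, a - b + c = 2y and b +
     c = 2x + y + z, and cyclically. *)
  assert (0 < y * z * (2 * x + y + z)^2) by positive.
  assert (0 < z * x * (x + 2 * y + z)^2) by positive.
  assert (0 < x * y * (x + y + 2 * z)^2) by positive.
  apply Rgt_not_eq. lra.
Qed.

Theorem mainTheorem11 : forall A B C : point,
  nondegenerate A B C ->
  distance (X_3 A B C) (X_9 A B C) <= distance (X_3 A B C) (X_10 A B C) /\
  distance (X_3 A B C) (X_10 A B C) <= distance (X_3 A B C) (X_2 A B C) /\
  distance (X_3 A B C) (X_2 A B C) <= distance (X_3 A B C) (X_12 A B C) /\
  distance (X_3 A B C) (X_12 A B C) <= distance (X_3 A B C) (X_7 A B C) /\
  distance (X_3 A B C) (X_7 A B C) <= distance (X_3 A B C) (X_4 A B C).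
Proof.
intros A B C HABC.
pose proof (double_area_neq0 A B C HABC) as Hd.
destruct (ravi (distance B C) (distance C A) (distance A B))
  as (x & y & z & (Hx & Hy & Hz) & Ea & Eb & Ec); try apply distance_nonneg.
(* Heron's product is positive because the triangle has nonzero area. *)
{ rewrite heron. rewrite <- Rsqr_pow2. pose proof (Rsqr_pos_lt _ Hd). lra. }
pose proof (inner_powers_sorted x y z Hx Hy Hz) as Hpow.
pose proof (weight_sums_neq0 x y z Hx Hy Hz) as Hsum.
cbv zeta in Hpow, Hsum. rewrite <- Ea, <- Eb, <- Ec in Hpow, Hsum.
repeat split; apply distance_circumcenter_le; tauto.
Qed.
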